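(* Consider any LTI system $$\mathcal{S}(\bm{\theta}^* ):\quad \bm{x}(t+1)=A\bm{x}(t)+B\bm{u}(t),\qquad \bm{y}(t)=C\bm{x}(t),$$ with $A\in\mathbb{R}^{p\times p}$, $B\in\mathbb{R}^{p\times l}$, $C\in\mathbb{R}^{m\times p}$, and an order-reduced model $$\mathcal{S}_r(\bm{\theta}^* ):\quad \bm{x}_r(t+1)=A_r\bm{x}_r(t)+B_r\bm{u}(t),\qquad \bm{y}_r(t)=C_r\bm{x}_r(t),$$ where $A_r=V_1^\top AV_2$, $B_r=V_1^\top B$, $C_r=CV_2$ for basis matrices $V_1,V_2\in\mathbb{R}^{p\times r}$ with $V_1^\top V_2=I_r$, $r<p$, and $r<l$. Denote $\bm{u}_r^*=\arg\min_{\bm{u}}J_r(\bm{u})$, the minimum being over all inputs $\bm{u}(t)\in\mathbb{R}^l$, where $$J_r(\bm{u})=\sum_{t=0}^{\infty}\left(\bm{y}_r^\top(t)Q\bm{y}_r(t)+\bm{u}^\top(t)R\bm{u}(t)\right),\qquad Q,R\succeq0,$$ and $\bm{y}_r$ satisfies the order-reduced model. Then $\bm{u}_r^*\in\mathcal{U}$, where $\mathcal{U}$ is the set of inputs satisfying the unidentifiability condition for $\mathcal{S}(\bm{\theta}^* )$.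
   Context: Setting: $\bm{x}(t)\in\mathbb{R}^p$, $\bm{y}(t)\in\mathbb{R}^m$, $\bm{u}(t)\in\mathbb{R}^l$; the system is assumed controllable and observable, with initial condition $\bm{x}(0)=0$. The reduced state is $\bm{x}_r(t)=V_1^\top\bm{x}(t)\in\mathbb{R}^r$ (with the approximation $\bm{x}(t)\approx V_2\bm{x}_r(t)$). All entries of $A,B,C$ are the parameters to be identified, collected in $\bm{\theta}\in\mathbb{R}^n$ with true value $\bm{\theta}^*$. Put $g_{i,j,k}=\frac{\partial (CA^{k-j-1}B)}{\partial\theta_i}$ (at $\bm{\theta}^*$) for $0\le j\le k-1$. Sensitivity matrix $W$ (depends on $\bm{u}$): $n$ columns, block row $k$ being $\left[\frac{\partial\bm{y}(k)}{\partial\theta_1},\dots,\frac{\partial\bm{y}(k)}{\partial\theta_n}\right]$ with $\frac{\partial\bm{y}(k)}{\partial\theta_i}=\sum_{j=0}^{k-1}g_{i,j,k}\bm{u}(j)$. Hessian matrix $H$: $n$ columns, the $i$-th column stacking over all $k,j$ the (vectorized) $\frac{\partial^2\bm{y}(k)}{\partial\theta_i\partial\bm{u}(j)}=g_{i,j,k}$. Unidentifiability set: $\mathcal{U}=\{\bm{u}:\exists\,\bm{v}\in\mathbb{R}^n,\ \|W\bm{v}\|=0,\ \|H\bm{v}\|>0\}$, with $W,H$ computed along the trajectory of $\mathcal{S}(\bm{\theta}^* )$ generated by $\bm{u}$.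
   Formalization: The minimizer of J_r is assumed to be unique (automatic for R ≻ 0 with finite cost), since with Q, R only semidefinite the claim fails for some minimizers, e.g. when Q = R = 0; the reduced initial state x_r(0) is arbitrary. *)

(* Defs.v *)
From HB Require Import structures.
From mathcomp Require Export all_boot all_order all_algebra.
From mathcomp Require Export all_classical all_reals all_analysis.

Set Implicit Arguments.
Unset Strict Implicit.
Unset Printing Implicit Defensive.

Export Order.TTheory GRing.Theory Num.Theory.
Export numFieldNormedType.Exports.

#[global] Open Scope classical_set_scope.
#[global] Open Scope ring_scope.

Section LinearSystem.
Context {K : realType} {p l m : nat}.
Implicit Types (A : 'M[K]_p) (B : 'M[K]_(p, l)) (C : 'M[K]_(m, p)).
Implicit Types (x : 'cV[K]_p) (u : nat -> 'cV[K]_l).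

Fixpoint state A B x0 u (t : nat) : 'cV[K]_p :=
  if t is t'.+1 then A *m state A B x0 u t' + B *m u t' else x0.

Definition output A B C x0 u (t : nat) : 'cV[K]_m := C *m state A B x0 u t.

Definition controllable A B : Prop :=
  forall x0 x1, exists (T : nat) (u : nat -> 'cV[K]_l), state A B x0 u T = x1.

Definition observable A B C : Prop :=
  forall u x0 x1, (forall t, output A B C x0 u t = output A B C x1 u t) ->
  x0 = x1.

End LinearSystem.

Section Identifiability.
Context {K : realType} {p l m : nat}.
Implicit Types (A : 'M[K]_p) (B : 'M[K]_(p, l)) (C : 'M[K]_(m, p)).
Implicit Types (u : nat -> 'cV[K]_l).

(* n = number of entries of (A, B, C); theta lists them in this order. *)
Definition nparam (p l m : nat) : nat := (p * p + (p * l + m * p))%N.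

Definition paramA (theta : 'rV[K]_(nparam p l m)) : 'M[K]_p :=
  vec_mx (lsubmx theta).
Definition paramB (theta : 'rV[K]_(nparam p l m)) : 'M[K]_(p, l) :=
  vec_mx (lsubmx (rsubmx theta)).
Definition paramC (theta : 'rV[K]_(nparam p l m)) : 'M[K]_(m, p) :=
  vec_mx (rsubmx (rsubmx theta)).

Definition true_param A B C : 'rV[K]_(nparam p l m) :=
  row_mx (mxvec A) (row_mx (mxvec B) (mxvec C)).

Definition partial {a b : nat} (F : 'rV[K]_(nparam p l m) -> 'M[K]_(a, b))
    (i : 'I_(nparam p l m)) (theta : 'rV[K]_(nparam p l m)) : 'M[K]_(a, b) :=
  'D_(delta_mx 0 i) F theta.

(* g_{i,j,k}, meaningful for j < k; the subtraction of naturals truncates. *)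
Definition markov_sens A B C (i : 'I_(nparam p l m)) (j k : nat) :
    'M[K]_(m, l) :=
  partial (fun theta => paramC theta *m paramA theta ^+ (k - j - 1)
                        *m paramB theta) i (true_param A B C).

(* dy(k)/dtheta_i along the trajectory driven by u from x(0) = 0; it equals
   the sum over j < k of markov_sens i j k *m u j, see output_sensE. *)
Definition output_sens A B C u (i : 'I_(nparam p l m)) (k : nat) : 'cV[K]_m :=
  partial (fun theta => output (paramA theta) (paramB theta) (paramC theta)
                          0 u k) i (true_param A B C).

(* Block row k of the sensitivity matrix W; the block row k = 0 vanishes. *)
Definition sens_row A B C u (k : nat) : 'M[K]_(m, nparam p l m) :=
  \matrix_(a, i) output_sens A B C u i k a 0.

(* Block row (k, j), with j < k, of the Hessian matrix H. *)
Definition hess_row A B C (k j : nat) : 'M[K]_(m * l, nparam p l m) :=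
  \matrix_(a, i) mxvec (markov_sens A B C i j k) 0 a.

Definition sqnorm {d : nat} (w : 'cV[K]_d) : K := \sum_a w a 0 ^+ 2.

(* W and H have infinitely many block rows (k ranges over all times), so the
   Euclidean norms of W v and H v are taken in the extended reals. *)
Definition norm_Wv A B C u (v : 'cV[K]_(nparam p l m)) : \bar K :=
  sqrte (\sum_(0 <= k <oo) (sqnorm (sens_row A B C u k *m v))%:E)%E.

Definition norm_Hv A B C (v : 'cV[K]_(nparam p l m)) : \bar K :=
  sqrte (\sum_(0 <= k <oo)
           (\sum_(j < k) sqnorm (hess_row A B C k j *m v))%:E)%E.

Definition unidentifiability_set A B C : set (nat -> 'cV[K]_l) :=
  [set u | exists v : 'cV[K]_(nparam p l m),
             norm_Wv A B C u v = 0%E /\ (0 < norm_Hv A B C v)%E].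

End Identifiability.

Section QuadraticCost.
Context {K : realType}.

Definition psd {d : nat} (M : 'M[K]_d) : Prop :=
  M^T = M /\ forall x : 'cV[K]_d, 0 <= (x^T *m M *m x) 0 0.

(* The value may be +oo. For x0 = 0 it is minimal at u = 0; the initial state
   is kept as a parameter. *)
Definition lqr_cost {r l m : nat} (A : 'M[K]_r) (B : 'M[K]_(r, l))
    (C : 'M[K]_(m, r)) (Q : 'M[K]_m) (R : 'M[K]_l) (x0 : 'cV[K]_r)
    (u : nat -> 'cV[K]_l) : \bar K :=
  (\sum_(0 <= t <oo)
     (((output A B C x0 u t)^T *m Q *m output A B C x0 u t
       + (u t)^T *m R *m u t) 0 0)%:E)%E.

(* The set of all minimizers; "u is the argmin of J" reads argmin J = [set u].
   A semidefinite cost may have several (for lqr_cost with Q = 0 and R = 0,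
   every input is one). *)
Definition argmin {T : Type} (J : T -> \bar K) : set T :=
  [set u | forall w, (J u <= J w)%E].

End QuadraticCost.

Section SensitivityFormula.
Context {K : realType}.

Lemma derivable_mulmx {V : normedModType K} {a b c : nat}
    (F : V -> 'M[K]_(a, b)) (G : V -> 'M[K]_(b, c)) (x v : V) :
  derivable F x v -> derivable G x v ->
  derivable (fun y => F y *m G y) x v.
Proof.
move=> /derivable_mxP dF /derivable_mxP dG; apply/derivable_mxP => i j.
under eq_fun do rewrite mxE.
pose h (k : 'I_b) (y : V) : K := F y i k * G y k j.
have dh k : derivable (h k) x v.
  exact: (@derivableM K V (fun y => F y i k) (fun y => G y k j)).
have := @derivable_sum _ _ _ b h x v dh.
have -> // : \sum_(k < b) h k = (fun y => \sum_k F y i k * G y k j).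
by apply/funext => y; rewrite fct_sumE.
Qed.

Lemma derivable_coord {a b q : nat} (f : 'I_a -> 'I_b -> 'I_q)
    (x v : 'rV[K]_q) :
  derivable (fun y : 'rV[K]_q => \matrix_(i < a, j < b) y 0 (f i j)) x v.
Proof.
apply/derivable_mxP => i j; under eq_fun do rewrite mxE.
exact/diff_derivable/differentiable_coord.
Qed.

Context {p l m : nat}.
Implicit Types theta v : 'rV[K]_(nparam p l m).

Lemma derivable_paramA theta v : derivable (@paramA K p l m) theta v.
Proof.
rewrite (_ : paramA = fun y : 'rV[K]_(nparam p l m) =>
  \matrix_(i, j) y 0 (lshift _ (mxvec_index i j))); last first.
  by apply/funext => y; apply/matrixP => i j; rewrite !mxE.
exact: derivable_coord.
Qed.

Lemma derivable_paramB theta v : derivable (@paramB K p l m) theta v.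
Proof.
rewrite (_ : paramB = fun y : 'rV[K]_(nparam p l m) =>
  \matrix_(i, j) y 0 (rshift _ (lshift _ (mxvec_index i j)))); last first.
  by apply/funext => y; apply/matrixP => i j; rewrite !mxE.
exact: derivable_coord.
Qed.

Lemma derivable_paramC theta v : derivable (@paramC K p l m) theta v.
Proof.
rewrite (_ : paramC = fun y : 'rV[K]_(nparam p l m) =>
  \matrix_(i, j) y 0 (rshift _ (rshift _ (mxvec_index i j)))); last first.
  by apply/funext => y; apply/matrixP => i j; rewrite !mxE.
exact: derivable_coord.
Qed.

Lemma derivable_paramAX (s : nat) theta v :
  derivable (fun th => @paramA K p l m th ^+ s) theta v.
Proof.
elim: s => [|s IH]; first exact: derivable_cst.
rewrite (_ : (fun _ => _) = fun th => paramA th *m paramA th ^+ s); last first.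
  by apply/funext => th; rewrite exprS.
by apply: derivable_mulmx => //; apply: derivable_paramA.
Qed.

Lemma derivable_markov (s : nat) theta v :
  derivable (fun th => @paramC K p l m th *m paramA th ^+ s *m paramB th)
    theta v.
Proof.
apply: derivable_mulmx; last exact: derivable_paramB.
apply: derivable_mulmx; first exact: derivable_paramC.
exact: derivable_paramAX.
Qed.

Lemma output_zero_state (A : 'M[K]_p) (B : 'M[K]_(p, l)) (C : 'M[K]_(m, p))
    u k :
  output A B C 0 u k = \sum_(j < k) C *m A ^+ (k - j - 1) *m B *m u j.
Proof.
have stE : state A B 0 u k = \sum_(j < k) A ^+ (k - j - 1) *m B *m u j.
  elim: k => [|k IH] /=; first by rewrite big_ord0.
  rewrite big_ord_recr /= subSnn subnn expr0 mul1mx IH mulmx_sumr.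
  congr (_ + _); apply: eq_bigr => j _; rewrite !mulmxA; congr (_ *m _ *m _).
  rewrite subSn 1?ltnW// subSS subn0.
  by rewrite -[in RHS](@subnK 1 (k - j)) ?subn_gt0// addn1 exprS.
by rewrite /output stE mulmx_sumr; apply: eq_bigr => j _; rewrite !mulmxA.
Qed.

Lemma derive_mulmxr {V : normedModType K} {a b c : nat}
    (F : V -> 'M[K]_(a, b)) (M : 'M[K]_(b, c)) (x v : V) :
  derivable F x v ->
  'D_v (fun y => F y *m M) x = 'D_v F x *m M.
Proof.
move=> dF.
have dFM : derivable (fun y => F y *m M) x v.
  by apply: derivable_mulmx => //; exact: derivable_cst.
rewrite !derive_mx//; apply/matrixP => i j; rewrite !mxE.
under eq_fun do rewrite mxE.
pose h (k : 'I_b) (y : V) : K := F y i k * M k j.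
have dFij k : derivable (fun y => F y i k : K) x v.
  exact: ((derivable_mxP _ _ _).1 dF).
have dM k : derivable (cst (M k j) : V -> K) x v by exact: derivable_cst.
have dh k : derivable (h k) x v by
  exact: (@derivableM _ _ (fun y => F y i k) (cst (M k j)) x v (dFij k) (dM k)).
have -> : (fun y => \sum_k F y i k * M k j) = \sum_(k < b) h k.
  by apply/funext => y; rewrite fct_sumE.
rewrite (@derive_sum _ _ _ b h x v dh); apply: eq_bigr => k _; rewrite mxE.
rewrite (@deriveM _ _ (fun y => F y i k) (cst (M k j)) x v (dFij k) (dM k)).
by rewrite derive_cst scaler0 add0r mulrC.
Qed.

Lemma output_sensE (A : 'M[K]_p) (B : 'M[K]_(p, l)) (C : 'M[K]_(m, p)) u i k :
  output_sens A B C u i k = \sum_(j < k) markov_sens A B C i j k *m u j.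
Proof.
rewrite /output_sens /partial; under eq_fun do rewrite output_zero_state.
set e := delta_mx 0 i; set th0 := true_param A B C.
pose h (j : 'I_k) (th : 'rV[K]_(nparam p l m)) :=
  paramC th *m paramA th ^+ (k - j - 1) *m paramB th *m u j.
have dh j : derivable (h j) th0 e.
  apply: derivable_mulmx; first exact: derivable_markov.
  exact: derivable_cst.
rewrite (_ : (fun _ => _) = \sum_(j < k) h j); last first.
  by apply/funext => y; rewrite fct_sumE.
rewrite (@derive_sum _ _ _ k h th0 e dh); apply: eq_bigr => j _.
by apply: derive_mulmxr; exact: derivable_markov.
Qed.

End SensitivityFormula.

(* Main.v *)
From mathcomp Require Import ring lra.
Require Import Defs.

(* If the minimizer u of the reduced problem is unique, then every linear
   relation sum_i c_i x_r(i) = 0 between its states forces sum_i c_i u(i) = 0: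
   the input h(s) = sum_i c_i u(i + s), started from state 0, produces the
   trajectory sum_i c_i z(i + .), where z is the optimal trajectory; first-order
   optimality of u against each delayed copy of h gives <z(i + .), h> = 0, so h
   has cost 0, u + h is optimal too, and h = 0.  Hence the u(t) span a space of
   dimension at most r < l, and some w <> 0 is orthogonal to all of them.
   Moving B in the direction b w^T with b <> 0 does not change the output to
   first order along u, while by observability it changes some Markov
   parameter C A^s B. *)

(** * Sums of a semidefinite form along sequences, and orthogonality at a minimum *)

Section QuadraticSums.
Set Implicit Arguments.
Unset Strict Implicit.
Unset Printing Implicit Defensive.

Context {K : realType} {d : nat}.
Implicit Types (M : 'M[K]_d) (x y : 'cV[K]_d) (z h : nat -> 'cV[K]_d).

Definition bform M x y : K := (x^T *m M *m y) 0 0.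

Lemma bformDl M x x' y : bform M (x + x') y = bform M x y + bform M x' y.
Proof. by rewrite /bform raddfD !mulmxDl mxE. Qed.

Lemma bformZl M c x y : bform M (c *: x) y = c * bform M x y.
Proof. by rewrite /bform linearZ -!scalemxAl mxE. Qed.

Lemma bformDr M x y y' : bform M x (y + y') = bform M x y + bform M x y'.
Proof. by rewrite /bform mulmxDr mxE. Qed.

Lemma bformZr M c x y : bform M x (c *: y) = c * bform M x y.
Proof. by rewrite /bform -scalemxAr mxE. Qed.

Lemma bform0r M x : bform M x 0 = 0.
Proof. by rewrite /bform mulmx0 mxE. Qed.

Lemma bform_suml M n (c : 'I_n -> K) (x : 'I_n -> 'cV_d) y :
  bform M (\sum_i c i *: x i) y = \sum_i c i * bform M (x i) y.
Proof.
rewrite /bform raddf_sum !mulmx_suml summxE.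
by apply: eq_bigr => i _; rewrite -bformZl.
Qed.

Lemma bformC M x y : psd M -> bform M x y = bform M y x.
Proof.
move=> [Msym _]; rewrite /bform.
rewrite (_ : y^T *m M *m x = (x^T *m M *m y)^T) ?mxE//.
by rewrite !trmx_mul Msym trmxK mulmxA.
Qed.

Definition qsum M z h (N : nat) : K := \sum_(t < N) bform M (z t) (h t).

(** For semidefinite [M] the partial sums are nondecreasing, so convergence amounts to boundedness,
    that is, to finite cost. *)
Definition sq_summable M z : Prop := cvgn (qsum M z z).

Variables (M : 'M[K]_d) (psdM : psd M).

Lemma qsum_nondecreasing z :
  {homo qsum M z z : n k / (n <= k)%N >-> n <= k}.
Proof.
apply/nondecreasing_seqP => n /=.
by rewrite /qsum big_ord_recr lerDl; case: psdM => _; apply.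
Qed.

Lemma qsum_ge0 z N : 0 <= qsum M z z N.
Proof. by apply: sumr_ge0 => t _; case: psdM => _; apply. Qed.

Lemma qsum_line c z h N :
  qsum M (fun t => z t + c *: h t) (fun t => z t + c *: h t) N
  = qsum M z z N + c *+ 2 * qsum M z h N + c ^+ 2 * qsum M h h N.
Proof.
rewrite /qsum !mulr_sumr -!big_split; apply: eq_bigr => t _ /=.
rewrite bformDl !bformDr !bformZl !bformZr (bformC (h t) (z t) psdM); ring.
Qed.

Lemma sq_summable_le z k :
  (forall N, qsum M z z N <= k) -> sq_summable M z.
Proof.
move=> zk; apply: nondecreasing_is_cvgn; first exact: qsum_nondecreasing.
by exists k => _ [N _ <-]; exact: zk.
Qed.

Lemma qsum_le_lim z N : sq_summable M z -> qsum M z z N <= limn (qsum M z z).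
Proof.
by move=> sz; apply: nondecreasing_cvgn_le => //; exact: qsum_nondecreasing.
Qed.

Lemma sq_summableD c z h : sq_summable M z -> sq_summable M h ->
  sq_summable M (fun t => z t + c *: h t).
Proof.
move=> sz sh; apply: (@sq_summable_le _
  (limn (qsum M z z) *+ 2 + c ^+ 2 * limn (qsum M h h) *+ 2)) => N.
(* Adding the nonnegative sum for [z - c h] cancels the cross term: this is the parallelogram
   bound. *)
have := qsum_ge0 (fun t => z t + (- c) *: h t) N.
rewrite !qsum_line.
have := qsum_le_lim N sz; have := qsum_le_lim N sh.
have := sqr_ge0 c; nra.
Qed.

Lemma sq_summable0 : sq_summable M (fun=> 0).
Proof.
apply: (@sq_summable_le _ 0) => N.
by rewrite /qsum big1// => t _; rewrite bform0r.
Qed.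

Lemma sq_summable_sum n (c : 'I_n -> K) (z : 'I_n -> nat -> 'cV_d) :
  (forall i, sq_summable M (z i)) ->
  sq_summable M (fun t => \sum_i c i *: z i t).
Proof.
move=> sz; elim: n c z sz => [|n IH] c z sz.
  under eq_fun do rewrite big_ord0; exact: sq_summable0.
under eq_fun do rewrite big_ord_recr.
by apply: sq_summableD => //; apply: IH.
Qed.

Lemma qsum_shift k z h N :
  qsum M z h (k + N)
  = qsum M z h k + qsum M (fun t => z (k + t)%N) (fun t => h (k + t)%N) N.
Proof. by rewrite /qsum big_split_ord. Qed.

Lemma sq_summable_shift k z :
  sq_summable M z -> sq_summable M (fun t => z (k + t)%N).
Proof.
move=> sz; apply: (@sq_summable_le _ (limn (qsum M z z))) => N.
apply: le_trans (qsum_le_lim (k + N) sz).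
by rewrite qsum_shift lerDr qsum_ge0.
Qed.

Definition delay k z (t : nat) : 'cV[K]_d :=
  if (t < k)%N then 0 else z (t - k)%N.

(** Delay is the adjoint of the shift: the first [k] terms vanish, and the remaining ones pair [h]
    with the shifted [z]. *)
Lemma qsum_delay k z h N :
  qsum M z (delay k h) (k + N) = qsum M (fun t => z (k + t)%N) h N.
Proof.
rewrite qsum_shift {1}/qsum big1 ?add0r => [|t _]; last first.
  by rewrite /delay ltn_ord bform0r.
apply: eq_bigr => t _; congr (bform _ _ _).
by rewrite /delay ltnNge leq_addr addKn.
Qed.

Lemma sq_summable_delay k z : sq_summable M z -> sq_summable M (delay k z).
Proof.
move=> sz; apply: (@sq_summable_le _ (limn (qsum M z z))) => N.
apply: le_trans (qsum_nondecreasing _ (leq_addl k N)) _.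
rewrite qsum_delay; apply: le_trans (qsum_le_lim N sz).
rewrite le_eqVlt; apply/orP; left; apply/eqP; apply: eq_bigr => t _.
by rewrite /delay ltnNge leq_addr addKn.
Qed.

(** Along the line [z + c h] the cost is the quadratic [a + 2 c beta + c^2 b], with [beta] the limit
    of the cross sums. A minimum at [c = 0] forces [beta = 0]. *)
Lemma optimal_orthogonal z h :
  sq_summable M z -> sq_summable M h ->
  (forall c, limn (qsum M z z)
     <= limn (qsum M (fun t => z t + c *: h t) (fun t => z t + c *: h t))) ->
  qsum M z h @ \oo --> 0.
Proof.
move=> sz sh opt.
pose s := qsum M (fun t => z t + 1 *: h t) (fun t => z t + 1 *: h t).
have ss : cvgn s by exact: sq_summableD.
set a := limn (qsum M z z); set b := limn (qsum M h h).
have za : qsum M z z @ \oo --> a by [].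
have hb : qsum M h h @ \oo --> b by [].
pose beta := (limn s - a - b) / 2.
have zhbeta : qsum M z h @ \oo --> beta.
  (* Polarization: the cross sums converge because the three square sums do. *)
  have -> : qsum M z h = fun N => (s N - qsum M z z N - qsum M h h N) / 2.
    by apply/funext => N; rewrite /s qsum_line; field.
  by apply: cvgMr_tmp; apply: cvgB => //; apply: cvgB.
have ineq c : 0 <= c *+ 2 * beta + c ^+ 2 * b.
  have := opt c.
  have -> : limn (qsum M (fun t => z t + c *: h t) (fun t => z t + c *: h t))
          = a + c *+ 2 * beta + c ^+ 2 * b.
    apply: cvg_lim => //.
    have -> : qsum M (fun t => z t + c *: h t) (fun t => z t + c *: h t)
            = fun N => qsum M z z N + c *+ 2 * qsum M z h N
                       + c ^+ 2 * qsum M h h N.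
      by apply/funext => N; rewrite qsum_line.
    by apply: cvgD; [apply: cvgD => //|]; apply: cvgMl_tmp.
  rewrite -/a; lra.
have b0 : 0 <= b by apply: limr_ge => //; apply: nearW => N; exact: qsum_ge0.
suff -> : 0 = beta by [].
have b1 : b + 1 != 0 by lra.
(* The vertex of the parabola is at [- beta / b], but [b] may be 0 for a semidefinite form; with
   [b + 1] as denominator the value is still negative unless [beta = 0]. *)
have := ineq (- beta / (b + 1)).
have -> : - beta / (b + 1) *+ 2 * beta + (- beta / (b + 1)) ^+ 2 * b
        = - (beta / (b + 1)) ^+ 2 * (b + 2) by field.
rewrite mulNr oppr_ge0 pmulr_lle0 ?ltr_wpDl// => le0.
have /eqP : (beta / (b + 1)) ^+ 2 = 0 by apply/le_anti; rewrite le0 sqr_ge0.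
by rewrite sqrf_eq0 mulf_eq0 invr_eq0 (negPf b1) orbF => /eqP ->.
Qed.

Local Notation cost z := (\sum_(0 <= t <oo) (bform M (z t) (z t))%:E)%E.

Lemma sq_summable_cost z :
  sq_summable M z -> cost z = (limn (qsum M z z))%:E.
Proof.
move=> sz; apply: cvg_lim => //.
have -> : (fun N => (\sum_(0 <= t < N) (bform M (z t) (z t))%:E)%E)
        = EFin \o qsum M z z.
  by apply/funext => N /=; rewrite sumEFin /qsum big_mkord.
by apply: cvg_EFin => //; exact: nearW.
Qed.

Lemma cost_sq_summable z : (cost z < +oo)%E -> sq_summable M z.
Proof.
have t0 t : true -> (0 <= (bform M (z t) (z t))%:E)%E.
  by move=> _; rewrite lee_fin; case: psdM => _; apply.
move=> zfin; apply: (@sq_summable_le _ (fine (cost z))) => N.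
rewrite -lee_fin fineK.
  rewrite /qsum -sumEFin -(big_mkord predT (fun t => (bform M (z t) (z t))%:E)).
  by apply: nneseries_lim_ge => t _; exact: t0.
by rewrite ge0_fin_numE//; apply: nneseries_ge0 => t _; exact: t0.
Qed.

End QuadraticSums.

(** * Trajectories as linear functions of initial state and input, and the unique minimizer *)

Section Trajectories.
Set Implicit Arguments.
Unset Strict Implicit.
Unset Printing Implicit Defensive.

Context {K : realType} {r l m : nat}.
Variables (A : 'M[K]_r) (B : 'M[K]_(r, l)) (C : 'M[K]_(m, r)).
Implicit Types (x : 'cV[K]_r) (u w : nat -> 'cV[K]_l).

Lemma state_line c x y u w t :
  state A B (x + c *: y) (fun s => u s + c *: w s) t
  = state A B x u t + c *: state A B y w t.
Proof.
elim: t => [//|t /= ->].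
by rewrite !mulmxDr -!scalemxAr scalerDr addrACA.
Qed.

Lemma state_sum n (c : 'I_n -> K) (x : 'I_n -> 'cV_r)
    (u : 'I_n -> nat -> 'cV_l) t :
  state A B (\sum_i c i *: x i) (fun s => \sum_i c i *: u i s) t
  = \sum_i c i *: state A B (x i) (u i) t.
Proof.
elim: t => [//|t /= ->]; rewrite !mulmx_sumr -big_split.
by apply: eq_bigr => i _ /=; rewrite scalerDr !scalemxAr.
Qed.

Lemma state_shift k x u t :
  state A B (state A B x u k) (fun s => u (k + s)%N) t = state A B x u (k + t).
Proof. by elim: t => [|t /= ->]; rewrite ?addn0 ?addnS. Qed.

(** Started from 0, the system stays at rest until the delayed input sets in. *)
Lemma state_delay k u t :
  state A B 0 (delay k u) t = delay k (state A B 0 u) t.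
Proof.
rewrite /delay; elim: t => [|t /= ->]; first by rewrite sub0n if_same.
have [tk|kt] := ltnP t k; last by rewrite ltnNge (leqW kt) subSn.
rewrite !mulmx0 addr0; case: ltnP => // kt.
by rewrite (_ : t.+1 - k = 0)%N//; apply/eqP; rewrite subn_eq0.
Qed.

(** Output and input are stacked so that the stage cost becomes one quadratic form, with the block
    diagonal matrix of [Q] and [R]. *)
Definition trajectory x u t : 'cV[K]_(m + l) :=
  col_mx (output A B C x u t) (u t).

Lemma trajectory_line c x y u w t :
  trajectory (x + c *: y) (fun s => u s + c *: w s) t
  = trajectory x u t + c *: trajectory y w t.
Proof.
rewrite /trajectory /output state_line mulmxDr -scalemxAr.
by rewrite scale_col_mx add_col_mx.
Qed.

Lemma trajectory_sum n (c : 'I_n -> K) (x : 'I_n -> 'cV_r)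
    (u : 'I_n -> nat -> 'cV_l) t :
  trajectory (\sum_i c i *: x i) (fun s => \sum_i c i *: u i s) t
  = \sum_i c i *: trajectory (x i) (u i) t.
Proof.
rewrite -[RHS]vsubmxK /trajectory /output state_sum mulmx_sumr !linear_sum.
congr col_mx; apply: eq_bigr => i _.
  by rewrite [in RHS]linearZ/= col_mxKu scalemxAr.
by rewrite linearZ/= col_mxKd.
Qed.

Lemma trajectory_shift k x u t :
  trajectory (state A B x u k) (fun s => u (k + s)%N) t
  = trajectory x u (k + t).
Proof. by rewrite /trajectory /output state_shift. Qed.

Lemma trajectory_delay k u t :
  trajectory 0 (delay k u) t = delay k (trajectory 0 u) t.
Proof.
rewrite /trajectory /output state_delay /delay.
by case: ifP => // _; rewrite mulmx0 col_mx0.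
Qed.

Variables (Q : 'M[K]_m) (R : 'M[K]_l).
Hypotheses (psdQ : psd Q) (psdR : psd R).

Let M : 'M[K]_(m + l) := block_mx Q 0 0 R.

Lemma bform_block y y' (v v' : 'cV[K]_l) :
  bform M (col_mx y v) (col_mx y' v') = bform Q y y' + bform R v v'.
Proof.
by rewrite /bform tr_col_mx mul_row_block !mulmx0 addr0 add0r mul_row_col mxE.
Qed.

Lemma psd_block : psd M.
Proof.
case: psdQ psdR => [Qsym Q0] [Rsym R0]; split.
  by rewrite tr_block_mx Qsym Rsym !trmx0.
move=> x; rewrite -[x]vsubmxK -/(bform _ _ _) bform_block.
by apply: addr_ge0; [exact: Q0|exact: R0].
Qed.

Lemma lqr_costE x u :
  lqr_cost A B C Q R x u
  = (\sum_(0 <= t <oo) (bform M (trajectory x u t) (trajectory x u t))%:E)%E.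
Proof.
by apply: eq_eseriesr => t _; rewrite bform_block /bform mxE.
Qed.

Lemma unique_minimizer_relation x u n (c : 'I_n -> K) : (0 < l)%N ->
  argmin (lqr_cost A B C Q R x) = [set u] ->
  \sum_i c i *: state A B x u i = 0 -> \sum_i c i *: u i = 0.
Proof.
move=> l0 argE xc0.
have uniq w : (lqr_cost A B C Q R x w <= lqr_cost A B C Q R x u)%E -> w = u.
  move=> wu; suff : argmin (lqr_cost A B C Q R x) w by rewrite argE.
  have : argmin (lqr_cost A B C Q R x) u by rewrite argE.
  by move=> umin w'; apply: le_trans (umin w').
have umin w : (lqr_cost A B C Q R x u <= lqr_cost A B C Q R x w)%E.
  have : argmin (lqr_cost A B C Q R x) u by rewrite argE.
  exact.
set z := trajectory x u.
have sz : sq_summable M z.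
  apply: (cost_sq_summable psd_block); rewrite -lqr_costE ltNge.
  (* If the optimal cost were infinite, every input would be optimal, in particular [u] shifted by
     the constant 1; [0 < l] provides an entry where the two differ. *)
  apply/negP => ufin.
  have /(congr1 (fun f : nat -> 'cV[K]_l => f 0%N (Ordinal l0) 0)) :
      (fun t => u t + const_mx 1) = u.
    by apply: uniq; apply: le_trans ufin; exact: leey.
  by rewrite !mxE => /eqP; rewrite -subr_eq0 addrAC subrr add0r oner_eq0.
pose h s := \sum_i c i *: u (i + s)%N.
pose zh := trajectory 0 h.
(* The relation [xc0] enters here: the combination of the shifted trajectories starts at
   [\sum_i c i *: state A B x u i], which is 0. *)
have zhE : zh = fun s => \sum_i c i *: z (i + s)%N.
  apply/funext => s; rewrite /zh -xc0 trajectory_sum.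
  by apply: eq_bigr => i _; rewrite trajectory_shift.
have szh : sq_summable M zh.
  rewrite zhE; apply: (sq_summable_sum psd_block) => i.
  exact: (sq_summable_shift psd_block).
(* A perturbation started from 0 leaves the initial state [x] unchanged, so [z] plus any multiple of
   it competes with [z]. *)
have ortho w : sq_summable M (trajectory 0 w) ->
    qsum M z (trajectory 0 w) @ \oo --> 0.
  move=> sw; apply: (optimal_orthogonal psd_block) => // e.
  have trE : (fun t => z t + e *: trajectory 0 w t)
           = trajectory x (fun t => u t + e *: w t).
    by apply/funext => t; rewrite -trajectory_line scaler0 addr0.
  have := umin (fun t => u t + e *: w t).
  rewrite !lqr_costE -trE !sq_summable_cost// ?lee_fin//.
  exact: (sq_summableD psd_block).
(* Orthogonality of [z] to [zh] delayed by [i] is orthogonality of [z] shifted by [i] to [zh]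
   itself. *)
have shifted (i : 'I_n) :
    qsum M (fun t => z (i + t)%N) zh @ \oo --> 0.
  have -> : qsum M (fun t => z (i + t)%N) zh
      = fun N => qsum M z (trajectory 0 (delay i h)) (N + i).
    apply/funext => N; rewrite -(qsum_delay _ i) (addnC i N).
    by congr qsum; apply/funext => t; rewrite trajectory_delay.
  rewrite (cvg_shiftn i); apply: ortho.
  rewrite (_ : trajectory 0 _ = delay i zh).
    exact: (sq_summable_delay psd_block).
  by apply/funext => t; rewrite trajectory_delay.
(* Expanding only the first argument by [zhE] reduces the cost of [h] to the pairings in
   [shifted]. *)
have zh0 : qsum M zh zh @ \oo --> 0.
  have -> : qsum M zh zh
      = fun N => \sum_i c i * qsum M (fun t => z (i + t)%N) zh N.
    apply/funext => N; rewrite /qsum.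
    under [RHS]eq_bigr do rewrite mulr_sumr.
    rewrite exchange_big; apply: eq_bigr => t _.
    by rewrite {1}zhE bform_suml.
  rewrite [X in _ --> X](_ : _ = \sum_(i < n) c i * 0); last first.
    by rewrite big1// => i _; rewrite mulr0.
  apply: cvg_big => [|i _]; first exact: add_continuous.
  exact: cvgMl_tmp.
have trE : (fun t => z t + 1 *: zh t) = trajectory x (fun t => u t + 1 *: h t).
  by apply/funext => t; rewrite -trajectory_line scaler0 addr0.
(* Both the cross term and the square term vanish in the limit, so [u + h] costs as much as [u] and
   uniqueness gives [h = 0]. Time 0 is the one to read off, since [h 0] is the wanted
   combination. *)
have /(congr1 (fun f : nat -> 'cV[K]_l => f 0%N)) :
    (fun t => u t + 1 *: h t) = u.
  apply: uniq; rewrite !lqr_costE -trE !sq_summable_cost// ?lee_fin; last first.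
    exact: (sq_summableD psd_block).
  rewrite (@cvg_lim _ _ _ _ _ _ (limn (qsum M z z)))//.
  have -> : qsum M (fun t => z t + 1 *: zh t) (fun t => z t + 1 *: zh t)
      = fun N => qsum M z z N + 1 *+ 2 * qsum M z zh N
                 + 1 ^+ 2 * qsum M zh zh N.
    by apply/funext => N; rewrite (qsum_line psd_block).
  rewrite -[X in _ --> X]addr0 -[X in _ --> X + _]addr0.
  rewrite -[X in _ --> _ + X + _](mulr0 (1 *+ 2)).
  rewrite -[X in _ --> _ + X](mulr0 (1 ^+ 2)).
  by apply: cvgD; [apply: cvgD => //|]; apply: cvgMl_tmp => //; exact: ortho.
rewrite /= scale1r => /(canRL (addKr _)).
rewrite addNr /h => h0; rewrite -[RHS]h0.
by apply: eq_bigr => i _; rewrite addn0.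
Qed.

End Trajectories.

(** * A nonzero vector orthogonal to all inputs *)

Section CommonKernel.
Set Implicit Arguments.
Unset Strict Implicit.
Unset Printing Implicit Defensive.

(** Relations between states carry over to inputs, so any finite stack of inputs has rank at most
    [r]. A stack of maximal rank already spans every [u t], and as [r < l] it has a nonzero
    cokernel. *)
Lemma common_left_kernel (F : fieldType) (r l : nat)
    (x : nat -> 'cV[F]_r) (u : nat -> 'cV[F]_l) : (r < l)%N ->
  (forall n (c : 'I_n -> F),
     \sum_i c i *: x i = 0 -> \sum_i c i *: u i = 0) ->
  exists2 w : 'cV[F]_l, w != 0 & forall t, w^T *m u t = 0.
Proof.
move=> rl rel.
pose U n : 'M[F]_(n, l) := \matrix_(i < n) (u (val i))^T.
pose X n : 'M[F]_(n, r) := \matrix_(i < n) (x (val i))^T.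
have rankU n : (\rank (U n) <= r)%N.
  (* By rank-nullity, a larger left kernel means a smaller rank, so the rank of [U n] is at most
     that of [X n], hence at most its column count [r]. *)
  suff kerXU : (kermx (X n) <= kermx (U n))%MS.
    have := mxrankS kerXU; rewrite !mxrank_ker leq_sub2lE ?rank_leq_row//.
    by move=> UX; apply: leq_trans UX (rank_leq_col _).
  apply/sub_kermxP/row_matrixP => k; rewrite row_mul row0.
  set c := row k _; have : c *m X n = 0 by apply/sub_kermxP; exact: row_sub.
  rewrite !mulmx_sum_row => /(congr1 trmx); rewrite trmx0 linear_sum /=.
  under eq_bigr do rewrite linearZ /= rowK trmxK.
  move=> /rel c0; apply: trmx_inj; rewrite trmx0 linear_sum -[RHS]c0 /=.
  by apply: eq_bigr => i _; rewrite linearZ /= rowK trmxK.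
pose P k := `[< exists n, \rank (U n) = k >].
have exP : exists k, P k by exists (\rank (U 0%N)); apply/asboolP; exists 0%N.
have ubP k : P k -> (k <= r)%N by move=> /asboolP [n <-].
case: (ex_maxnP exP ubP) => _ /asboolP [n <-] maxn.
have /matrix0Pn [a [b nz]] : cokermx (U n) != 0.
  by rewrite -mxrank_eq0 mxrank_coker -lt0n subn_gt0 (leq_ltn_trans _ rl).
exists (col b (cokermx (U n))).
  by apply/matrix0Pn; exists a, 0; rewrite mxE.
move=> t; apply: trmx_inj; rewrite trmx_mul trmxK trmx0 colE mulmxA.
rewrite -[RHS](mul0mx _ (delta_mx b 0)); congr mulmx.
have sub q : (n <= q)%N -> (U n <= U q)%MS.
  move=> nq; apply/row_subP => i.
  rewrite (_ : row i (U n) = row (widen_ord nq i) (U q)) ?row_sub//.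
  by rewrite !rowK.
(* The stack of length [n + t.+1] contains both [U n] and row [t]; by maximality its row space is
   that of [U n], so [cokermx (U n)] annihilates [u t]. *)
have ntq : (t < n + t.+1)%N by rewrite ltn_addl.
have /mxrank_leqif_eq [_ rk] := sub _ (leq_addr t.+1 n).
have : (U n == U (n + t.+1)%N)%MS.
  rewrite -rk eqn_leq mxrankS ?sub ?leq_addr//= maxn//.
  by apply/asboolP; exists (n + t.+1)%N.
move=> /andP [_]; rewrite submxE => /eqP/(congr1 (row (Ordinal ntq))).
by rewrite row_mul rowK row0.
Qed.

End CommonKernel.

(** * Sensitivities along perturbations of [B] *)

Section Sensitivity.
Set Implicit Arguments.
Unset Strict Implicit.
Unset Printing Implicit Defensive.

Context {K : realType}.

(** The difference quotient is constantly [D] away from [h = 0]. *)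
Lemma derive_affine (V W : normedModType K) (f : V -> W) (a v : V) (D : W) :
  (forall h : K, f (h *: v + a) = f a + h *: D) -> 'D_v f a = D.
Proof.
move=> fE; apply: lim_near_cst; first exact: norm_hausdorff.
near=> h; rewrite /= fE addrC addKr scalerA mulVf ?scale1r//.
by near: h; exact: nbhs_dnbhs_neq.
Unshelve. all: by end_near.
Qed.

Context {p l m : nat}.
Variables (A : 'M[K]_p) (B : 'M[K]_(p, l)) (C : 'M[K]_(m, p)).

(** The tangent vector that moves [B] along [D] and fixes [A] and [C], in the block order of
    [true_param]. *)
Definition paramB_direction (D : 'M[K]_(p, l)) : 'cV[K]_(nparam p l m) :=
  (row_mx 0 (row_mx (mxvec D) 0))^T.

(** With [A] and [C] fixed the Markov parameter is linear in [B], so [derive_affine] applies. *)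
Lemma markov_sens_paramB j k (i : 'I_(p * l)) :
  markov_sens A B C (rshift (p * p) (lshift (m * p) i)) j k
  = C *m A ^+ (k - j - 1) *m vec_mx 'e_i.
Proof.
apply: derive_affine => h.
rewrite delta_mx_rshift delta_mx_lshift /true_param !(scale_row_mx, add_row_mx).
rewrite /paramA /paramB /paramC !(row_mxKl, row_mxKr) !scaler0 !add0r.
by rewrite !mxvecK linearD linearZ/= mxvecK mulmxDr -scalemxAr addrC.
Qed.

Lemma markov_sens_direction j k D :
  \sum_i paramB_direction D i 0 *: markov_sens A B C i j k
  = C *m A ^+ (k - j - 1) *m D.
Proof.
rewrite big_split_ord /= [X in X + _]big1 ?add0r => [|i _]; last first.
  by rewrite mxE row_mxEl mxE scale0r.
rewrite big_split_ord /= [X in _ + X]big1 ?addr0 => [|i _]; last first.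
  by rewrite mxE row_mxEr row_mxEr mxE scale0r.
rewrite -[in RHS](mxvecK D) [mxvec D in RHS]row_sum_delta linear_sum mulmx_sumr.
apply: eq_bigr => i _; rewrite linearZ/= -scalemxAr markov_sens_paramB.
by rewrite mxE row_mxEr row_mxEl.
Qed.

Lemma sens_row_direction u k D :
  sens_row A B C u k *m paramB_direction D
  = \sum_(j < k) C *m A ^+ (k - j - 1) *m D *m u j.
Proof.
transitivity (\sum_i paramB_direction D i 0 *: output_sens A B C u i k).
  apply/colP => a; rewrite mxE summxE; apply: eq_bigr => i _.
  by rewrite [in LHS]mxE [in RHS]mxE mulrC.
under eq_bigr do rewrite output_sensE scaler_sumr.
rewrite exchange_big; apply: eq_bigr => j _ /=.
rewrite -markov_sens_direction mulmx_suml.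
by apply: eq_bigr => i _; rewrite scalemxAl.
Qed.

Lemma hess_row_direction k j D :
  hess_row A B C k j *m paramB_direction D
  = (mxvec (C *m A ^+ (k - j - 1) *m D))^T.
Proof.
rewrite -markov_sens_direction; apply/colP => a.
rewrite [RHS]mxE linear_sum summxE mxE; apply: eq_bigr => i _.
by rewrite linearZ [RHS]mxE [in LHS]mxE mulrC.
Qed.

Lemma sqnorm_ge0 d (x : 'cV[K]_d) : 0 <= sqnorm x.
Proof. by apply: sumr_ge0 => a _; exact: sqr_ge0. Qed.

Lemma sqnorm_gt0 d (x : 'cV[K]_d) : x != 0 -> 0 < sqnorm x.
Proof.
move=> x0; rewrite lt_neqAle sqnorm_ge0 andbT eq_sym; apply: contra x0.
rewrite psumr_eq0 => [|a _]; last exact: sqr_ge0.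
move=> /allP x0; apply/eqP/colP => a.
by have := x0 a (mem_index_enum a); rewrite sqrf_eq0 mxE => /eqP.
Qed.

Lemma norm_Wv_eq0 u v : (forall k, sens_row A B C u k *m v = 0) ->
  norm_Wv A B C u v = 0%E.
Proof.
move=> Wv0; rewrite /norm_Wv eseries0 ?sqrte0// => k _ _.
by rewrite Wv0 /sqnorm big1// => a _; rewrite mxE expr0n.
Qed.

Lemma norm_Hv_gt0 v k j : (j < k)%N -> hess_row A B C k j *m v != 0 ->
  (0 < norm_Hv A B C v)%E.
Proof.
move=> jk Hv0.
have t0 i : 0 <= \sum_(j < i) sqnorm (hess_row A B C i j *m v).
  by apply: sumr_ge0 => ? _; exact: sqnorm_ge0.
have Sgt0 : (0 < \sum_(0 <= k <oo)
           (\sum_(j < k) sqnorm (hess_row A B C k j *m v))%:E)%E.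
  apply: lt_le_trans (nneseries_lim_ge k.+1 _); last first.
    by move=> i _ _; rewrite lee_fin.
  rewrite sumEFin lte_fin big_nat_recr//= ltr_wpDl//.
    by apply: sumr_ge0 => i _; exact: t0.
  rewrite (bigD1 (Ordinal jk))//= ltr_wpDr ?sqnorm_gt0//.
  by apply: sumr_ge0 => ? _; exact: sqnorm_ge0.
(* Positivity passes to the square root because a zero root would square to a zero sum. *)
rewrite /norm_Hv lt0e sqrte_ge0 andbT; apply/eqP => S0.
by have := Sgt0; rewrite -(sqr_sqrte (ltW Sgt0)) S0 expe2 mule0 ltxx.
Qed.

(** If all [C A^s b] vanished, the zero-input outputs from [b] and from 0 would agree, and
    observability would give [b = 0]. *)
Lemma observable_markov (b : 'cV[K]_p) :
  observable A B C -> b != 0 -> exists s, C *m A ^+ s *m b != 0.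
Proof.
move=> obs; apply: contra_neqP => /forallNP Cb0.
have stE s : state A B b (fun=> 0) s = A ^+ s *m b.
  by elim: s => [|s /= ->]; rewrite ?mul1mx// mulmx0 addr0 exprS mulmxA.
have st0 s : state A B 0 (fun=> 0) s = 0.
  by elim: s => [//|s /= ->]; rewrite !mulmx0 addr0.
apply: (obs (fun=> 0)) => s; rewrite /output stE st0 mulmx0 mulmxA.
by apply/eqP/negPn/negP.
Qed.

Lemma degenerate_input_unidentifiable u (w : 'cV[K]_l) :
  observable A B C -> (0 < p)%N -> w != 0 -> (forall t, w^T *m u t = 0) ->
  unidentifiability_set A B C u.
Proof.
move=> obs p0 /matrix0Pn [a [a' wa0]] wu0.
have b0 : const_mx 1 != 0 :> 'cV[K]_p.
  by apply/matrix0Pn; exists (Ordinal p0), 0; rewrite mxE oner_eq0.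
have [s /matrix0Pn [i [i' Cb0]]] := observable_markov obs b0.
(* For [D = b w^T] each term of the output sensitivity contains the factor [w^T *m u j = 0]. *)
exists (paramB_direction (const_mx 1 *m w^T)); split.
  apply: norm_Wv_eq0 => k; rewrite sens_row_direction big1// => j _.
  by rewrite -!mulmxA wu0 !mulmx0.
(* Block row [(s.+1, 0)] carries the exponent [s.+1 - 0 - 1 = s]; its entry at [(i, a)] is a product
   of two nonzero scalars. *)
apply: (@norm_Hv_gt0 _ s.+1 0) => //.
rewrite hess_row_direction subn0 subn1 /= trmx_eq0 mxvec_eq0 mulmxA.
apply/matrix0Pn; exists i, a.
rewrite ord1 in wa0; rewrite ord1 in Cb0.
by rewrite mxE big_ord1 [w^T _ _]mxE mulf_neq0.
Qed.

End Sensitivity.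

Theorem corollary4 (K : realType) (p l m r : nat)
  (A : 'M[K]_p) (B : 'M[K]_(p, l)) (C : 'M[K]_(m, p))
  (V1 V2 : 'M[K]_(p, r)) (Q : 'M[K]_m) (R : 'M[K]_l)
  (xr0 : 'cV[K]_r) (ur : nat -> 'cV[K]_l) :
  controllable A B -> observable A B C ->
  \rank V1 = r -> \rank V2 = r -> V1^T *m V2 = 1%:M ->
  (r < p)%N -> (r < l)%N ->
  psd Q -> psd R ->
  argmin (lqr_cost (V1^T *m A *m V2) (V1^T *m B) (C *m V2) Q R xr0)
    = [set ur] ->
  ur \in unidentifiability_set A B C.
Proof.
move=> _ obs _ _ _ rp rl psdQ psdR argE; rewrite inE.
have rel n (c : 'I_n -> K) := unique_minimizer_relation psdQ psdR (c := c)
  (leq_ltn_trans (leq0n r) rl) argE.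
have [w w0 wu0] := common_left_kernel rl rel.
exact: degenerate_input_unidentifiable obs (leq_ltn_trans (leq0n r) rp) w0 wu0.
Qed.
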